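(* Let $\sigma\in C(\mathbb{R},\mathbb{R})$ be a function which is not a polynomial, and let $\mathbf{F}_\sigma$ be the family of all kernels on $\mathbb{R}^n\times\mathbb{R}^n$ of the form \[ \mathbf{k}(x,y\,|\,\theta)=\sum_{j=1}^{m}c_j\,\sigma(\langle x,w_j\rangle+b_j)\,\sigma(\langle y,w_j\rangle+b_j), \] where $\theta=(c,w,b)$, $m\in\mathbb{N}$, $c_j>0$, $b_j\in\mathbb{R}$, $w_j\in\mathbb{R}^n$. Then $\mathbf{F}_\sigma$ is universal: for every continuous $f:\mathbb{R}^n\to\mathbb{R}$, every compact $K\subset\mathbb{R}^n$ and every $\epsilon>0$ there exist $\mathbf{k}\in\mathbf{F}_\sigma$, an integer $s\in\mathbb{N}$, coefficients $d_1,\dots,d_s\in\mathbb{R}$ and points $x_1,\dots,x_s\in\mathbb{R}^n$ such that \[ \sup_{x\in K}\Big|f(x)-\sum_{l=1}^{s}d_l\,\mathbf{k}(x,x_l)\Big|<\epsilon . \]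
   Context: $\langle\cdot,\cdot\rangle$ denotes the standard inner product on $\mathbb{R}^n$. *)

(* Defs.v *)
From HB Require Import structures.
From mathcomp Require Import all_boot all_order all_algebra.
From mathcomp Require Import all_classical all_reals all_analysis.
Set Implicit Arguments. Unset Strict Implicit. Unset Printing Implicit Defensive.
Import Order.TTheory GRing.Theory Num.Theory.
Import numFieldNormedType.Exports.
Local Open Scope ring_scope.
Local Open Scope classical_set_scope.

Definition dotp (R : realType) (n : nat) (x y : 'rV[R]_n) : R :=
  \sum_(i < n) x ord0 i * y ord0 i.

Definition is_poly_fun (R : realType) (sigma : R -> R) : Prop :=
  exists p : {poly R}, forall t, sigma t = p.[t].

Definition in_F_sigma (R : realType) (n : nat) (sigma : R -> R)
    (k : 'rV[R]_n -> 'rV[R]_n -> R) : Prop :=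
  exists (m : nat) (c : 'I_m -> R) (w : 'I_m -> 'rV[R]_n) (b : 'I_m -> R),
    (forall j, 0 < c j) /\
    forall x y, k x y = \sum_(j < m) c j * sigma (dotp x (w j) + b j)
                                      * sigma (dotp y (w j) + b j).

(* Main.v *)
(* A continuous function on a compact set is first approximated by a network
   sum_j a_j sigma(<x, w_j> + b_j), and the network is then rewritten exactly as a
   combination of sections of the kernel with the same w_j, b_j and with c_j = 1:
   the vector a may be replaced by its orthogonal projection on the span of the
   feature vectors, and this span is generated by finitely many of them.

   For the density of networks, write Delta_h g (t) = g (t + h) - g t.  If G is an
   antiderivative of g, then Delta_h G is a limit of Riemann sums of translates of
   g, and its derivative is Delta_h g.  So the k-fold iterate of this averaging,
   applied to sigma, yields a C^k function g_k with k-th derivative Delta_h^k sigma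
   whose ridge functions g_k (<x, w> + b) are limits of networks.  Differentiating
   k times in w, in the directions u_1, ..., u_k, at w = 0 shows that
   <x, u_1> ... <x, u_k> Delta_h^k sigma (b) is a limit of networks.  Since sigma is
   not a polynomial, for each k some Delta_h^k sigma (b) does not vanish; hence all
   polynomials are limits of networks, and Bernstein approximation concludes. *)
Require Import Defs.
From HB Require Import structures.
From mathcomp Require Import all_boot all_order all_algebra.
From mathcomp Require Import all_classical all_reals all_analysis.
From mathcomp Require Import ring lra.
Set Implicit Arguments. Unset Strict Implicit. Unset Printing Implicit Defensive.
Import Order.TTheory GRing.Theory Num.Theory.
Import numFieldNormedType.Exports.
Local Open Scope ring_scope.
Local Open Scope classical_set_scope.

(** * Compactness, uniform continuity and antiderivatives *)

Lemma continuous_compact_bounded (R : realType) (V : normedModType R)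
    (f : V -> R) (K : set V) :
  continuous f -> compact K -> exists2 M, 0 < M & forall x, K x -> `|f x| <= M.
Proof.
move=> cf cK; have /compact_bounded : compact (f @` K).
  by apply: continuous_compact => //; exact: continuous_subspaceT.
case=> M [_ HM]; exists (`|M| + 1); first by rewrite ltr_pwDr.
move=> x Kx; apply: (HM (`|M| + 1)); last by exists x.
by rewrite ltr_pwDr// ler_norm.
Qed.

(** Only [x] is confined to [K]: the mean value points later used as [y] need not lie in the compact
    interval. *)
Lemma heine_cantor (R : realType) (V : normedModType R) (f : V -> R)
    (K : set V) (eps : R) : continuous f -> compact K -> 0 < eps ->
  exists2 d, 0 < d & forall x y, K x -> `|x - y| < d -> `|f x - f y| < eps.
Proof.
move=> cf /compact_near_coveringP cK e0.
have := cK _ (at_right (0 : R)) (fun d x => forall y, `|x - y| < d -> `|f x - f y| < eps) _.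
case.
  move=> x Kx.
  have e20 : 0 < eps / 2 by lra.
  have /cvgrPdist_lt /(_ _ e20) /nbhs_normP[r /= r0 rP] := cf x.
  exists (ball x (r / 2), [set d | 0 < d < r / 2]) => /=.
    split; first by apply: nbhsx_ballx; lra.
    near=> d; apply/andP; split => //.
    by near: d; apply: nbhs_right_lt; lra.
  move=> [x' d] /= [xx' /andP[d0 dr]] y x'y.
  move: xx'; rewrite -ball_normE /= => xx'.
  have h1 := rP x'; have h2 := rP y; rewrite /= in h1 h2.
  have {}h1 : `|f x - f x'| < eps / 2 by apply: h1; rewrite /ball_/=; lra.
  have {}h2 : `|f x - f y| < eps / 2.
    apply: h2; rewrite /ball_/=; have := ler_normD (x - x') (x' - y).
    rewrite addrA subrK; lra.
  have := ler_distD (f x) (f x') (f y); rewrite (distrC (f x') (f x)); lra.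
move=> d /= d0 P; exists (d / 2); first by lra.
move=> x y Kx xy; apply: (P (d / 2)) => //=; last by lra.
by rewrite sub0r normrN gtr0_norm; lra.
Unshelve. all: end_near. Qed.

(** An integral from a fixed base point is handled only to the right of that point. So the base
    point moves with [x], and subtracting the integral up to 0 makes the value independent of it. *)
Lemma continuous_antiderivative (R : realType) (g : R -> R) : continuous g ->
  exists G : R -> R, forall x : R, is_derive x 1 G (g x).
Proof.
move=> cg; pose mu := @lebesgue_measure R.
have ig a b : mu.-integrable `[a, b] (EFin \o g).
  apply: continuous_compact_integrable; first exact: segment_compact.
  exact: continuous_subspaceT.
pose I a x := (\int[mu]_(t in `[a, x]) g t)%R.
have dI (a x : R) : a < x -> is_derive x 1 (I a) (g x).
  move=> ax; have xx1 : x < x + 1 by rewrite ltrDl.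
  have [d e] := continuous_FTC1_closed xx1 (ig _ _) ax (cg x).
  by apply: (DeriveDef d); rewrite -derive1E; exact: e.
have IS (a b x : R) : a <= b -> b <= x -> I a x = I a b + I b x.
  move=> ab bx; rewrite /I.
  have iab : mu.-integrable `]b, x] (EFin \o g).
    by apply: integrableS (ig b x) => //; exact: subset_itv_oc_cc.
  rewrite -(Rintegral_itv_obnd_cbnd iab) -(@Rintegral_itvB _ g _ _ b (ig a x)) ?bnd_simp//.
  by rewrite addrC subrK.
exists (fun x => I (- (`|x| + 1)) x - I (- (`|x| + 1)) 0) => x.
(* For [y] within 1 of [x], this [a] lies below the base point of [y], so additivity allows [a] as
   common base point near [x]. *)
pose a := - (`|x| + 2).
have ax : a < x by have := ler_norm (- x); rewrite normrN /a; lra.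
apply: (@near_eq_is_derive _ _ _ (fun y => I a y - I a 0)); last first.
  have := dI _ _ ax => ?.
  by rewrite -[g x]subr0; apply: is_deriveB.
near=> y.
have xy : `|x - y| < 1.
  by near: y; apply/nbhs_normP; exists 1 => //=.
have := ler_norm (- y); rewrite normrN => y1.
have := ler_normB x (x - y); rewrite subKr => y2.
have := normr_ge0 y => y3.
by rewrite (IS a (- (`|y| + 1)) y) ?(IS a (- (`|y| + 1)) 0); rewrite /a; lra.
Unshelve. all: end_near. Qed.

(** * Networks, their limits on compact sets, and ridge functions *)

Definition net (R : realType) (n : nat) (sigma : R -> R)
    (s : seq (R * ('rV[R]_n * R))) (x : 'rV[R]_n) : R :=
  \sum_(p <- s) p.1 * sigma (dotp x p.2.1 + p.2.2).

Definition approximable (R : realType) (n : nat) (sigma : R -> R)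
    (f : 'rV[R]_n -> R) : Prop :=
  forall (K : set 'rV[R]_n) (eps : R), compact K -> 0 < eps ->
    exists s, forall x, K x -> `|f x - net sigma s x| <= eps.

Definition shift_diff (R : realType) (h : R) (g : R -> R) (t : R) : R :=
  g (t + h) - g t.

Section Approximable.
Variables (R : realType) (n : nat) (sigma : R -> R).
Implicit Types (f g : 'rV[R]_n -> R) (us : seq 'rV[R]_n).

Lemma continuous_dotp u : continuous (fun x : 'rV[R]_n => dotp x u).
Proof.
apply: (continuous_big (@add_continuous R^o)) => i _ x.
by apply: (cvgM (@coord_continuous R 1 n ord0 i x)); exact: cvg_cst.
Qed.

Lemma continuous_prod_dotp us :
  continuous (fun x : 'rV[R]_n => \prod_(u <- us) dotp x u).
Proof.
elim: us => [|u us IH].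
  by rewrite (_ : (fun _ => _) = cst 1);
    [exact: cst_continuous|apply/funext => y; rewrite big_nil].
rewrite (_ : (fun _ => _) =
    (fun x => dotp x u) \* (fun x => \prod_(v <- us) dotp x v)).
  by move=> x; apply: continuousM; [exact: continuous_dotp|exact: IH].
by apply/funext => y; rewrite big_cons.
Qed.

Lemma dotpDr (x u v : 'rV[R]_n) : dotp x (u + v) = dotp x u + dotp x v.
Proof. by rewrite -big_split/=; apply: eq_bigr => i _; rewrite mxE mulrDr. Qed.

Lemma dotpZr (a : R) (x u : 'rV[R]_n) : dotp x (a *: u) = a * dotp x u.
Proof. by rewrite mulr_sumr; apply: eq_bigr => i _; rewrite mxE mulrCA. Qed.

Lemma dotp0r (x : 'rV[R]_n) : dotp x 0 = 0.
Proof. by rewrite /dotp big1// => i _; rewrite mxE mulr0. Qed.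

Lemma approximable_uniform f :
  (forall K eps, compact K -> 0 < eps -> exists2 g, approximable sigma g &
     forall x, K x -> `|f x - g x| <= eps) -> approximable sigma f.
Proof.
move=> H K eps cK e0; have e20 : 0 < eps / 2 by lra.
have [g /(_ K _ cK e20)[s sP] gP] := H K _ cK e20.
exists s => x Kx; have := sP x Kx; have := gP x Kx.
by have := ler_distD (g x) (f x) (net sigma s x); lra.
Qed.

Lemma approximable_add f g : approximable sigma f -> approximable sigma g ->
  approximable sigma (fun x => f x + g x).
Proof.
move=> Hf Hg K eps cK e0; have e20 : 0 < eps / 2 by lra.
have [s sP] := Hf K _ cK e20; have [t tP] := Hg K _ cK e20.
exists (s ++ t) => x Kx; rewrite /net big_cat/= opprD addrACA.
apply: le_trans (ler_normD _ _) _.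
by have := sP x Kx; have := tP x Kx; rewrite /net; lra.
Qed.

Lemma approximable_scale (a : R) f : approximable sigma f ->
  approximable sigma (fun x => a * f x).
Proof.
move=> Hf K eps cK e0.
have a1 : 0 < `|a| + 1 by rewrite ltr_wpDl.
have [s sP] := Hf K _ cK (divr_gt0 e0 a1).
exists [seq (a * p.1, p.2) | p <- s] => x Kx.
rewrite /net big_map/=; under eq_bigr do rewrite -mulrA.
rewrite -mulr_sumr -mulrBr normrM.
have := sP x Kx; rewrite ler_pdivlMr//; apply: le_trans.
by rewrite mulrC ler_wpM2l// lerDl.
Qed.

Lemma approximable_eq f g : f =1 g -> approximable sigma f -> approximable sigma g.
Proof. by move=> /funext ->. Qed.

Lemma approximable_sum (I : Type) (r : seq I) (F : I -> 'rV[R]_n -> R) :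
  (forall i, approximable sigma (F i)) ->
  approximable sigma (fun x => \sum_(i <- r) F i x).
Proof.
move=> H; elim: r => [|i r IH].
  move=> K eps cK e0; exists [::] => x _.
  by rewrite /net !big_nil subrr normr0 ltW.
apply: (@approximable_eq (fun x => F i x + \sum_(j <- r) F j x)).
  by move=> x; rewrite big_cons.
exact: approximable_add.
Qed.

(** The product collects the factors produced by differentiating in [w]. Quantifying over all [w]
    makes difference quotients in [w] available. *)
Definition ridge_approximable us (g : R -> R) : Prop := forall w b,
  approximable sigma (fun x => (\prod_(u <- us) dotp x u) * g (dotp x w + b)).

Lemma ridge_approximable_sigma : ridge_approximable [::] sigma.
Proof.
move=> w b K eps cK e0; exists [:: (1, (w, b))] => x _.
by rewrite /net big_seq1 big_nil/= subrr normr0 ltW.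
Qed.

(** The intermediate point is located by a distance, which covers both orders of [a] and [b]; the
    increments used later have arbitrary sign. *)
Lemma MVT_derive (G g : R -> R) (a b : R) :
  (forall x : R, is_derive x 1 G (g x)) -> exists2 c, `|c - a| <= `|b - a| &
  G b - G a = g c * (b - a).
Proof.
move=> dG.
have cG : continuous G.
  by move=> x; apply: differentiable_continuous; apply/derivable1_diffP; have [] := dG x.
have [ab|/ltW ba] := leP a b.
  have [c /[!in_itv]/= /andP[ac cb] ->] := MVT_segment ab (fun x _ => dG x) (continuous_subspaceT cG).
  by exists c => //; rewrite !ger0_norm ?lerD2r// subr_ge0//; exact: le_trans cb.
have [c /[!in_itv]/= /andP[ac cb] E] := MVT_segment ba (fun x _ => dG x) (continuous_subspaceT cG).
exists c; first by rewrite !ler0_norm ?lerN2 ?lerD2r// subr_le0//; exact: le_trans ba.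
by rewrite -opprB E -mulrN opprB.
Qed.

(* By the mean value theorem on a fine subdivision, G (t + h) - G t is close to a
   Riemann sum of translates of g, uniformly for t in a compact set. *)
Lemma ridge_approximable_integral (h : R) (g G : R -> R) : continuous g ->
  (forall x : R, is_derive x 1 G (g x)) -> ridge_approximable [::] g ->
  ridge_approximable [::] (shift_diff h G).
Proof.
move=> cg dG gA w b; apply: approximable_uniform => K eps cK e0.
have [B B0 HB] := @continuous_compact_bounded _ _ _ K (@continuous_dotp w) cK.
(* All nodes [t + i q] with [i < N] lie in [[-C, C]], because [|i q| <= |h|]. The tolerance is
   divided by [|h| + 1], so that [h = 0] is harmless. *)
pose C := B + `|b| + `|h|.
have h0 : 0 < `|h| + 1 by rewrite ltr_wpDl.
have [d d0 dP] := @heine_cantor _ _ _ `[- C, C] _ cg (@segment_compact _ _ _) (divr_gt0 e0 h0).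
pose N := (Num.truncn (`|h| / d)).+1.
have N0 : 0 < N%:R :> R by [].
have hN : `|h / N%:R| < d.
  rewrite normrM normfV (gtr0_norm N0) ltr_pdivrMr// mulrC -ltr_pdivrMr//.
  exact: Num.Theory.truncnS_gt.
exists (fun x => \sum_(i <- iota 0 N) (h / N%:R) * (1 * g (dotp x w + (b + i%:R * (h / N%:R))))).
  apply: approximable_sum => i; apply: approximable_scale.
  have := gA w (b + i%:R * (h / N%:R)).
  by apply: approximable_eq => x; rewrite big_nil.
move=> x Kx; rewrite big_nil mul1r /shift_diff.
set t := _ + b; set q := h / N%:R in hN *.
have -> : G (t + h) - G t = \sum_(i <- iota 0 N) (G (t + i.+1%:R * q) - G (t + i%:R * q)).
  rewrite -[iota 0 N]/(index_iota 0 N) telescope_sumr// mul0r addr0.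
  by rewrite /q mulrCA divff ?mulr1// gt_eqF.
rewrite -sumrB.
apply: (@le_trans _ _ (\sum_(i <- iota 0 N) eps / N%:R)); last first.
  by rewrite big_const_seq count_predT size_iota iter_addr_0 -[X in X <= _]mulr_natr divfK// gt_eqF.
apply: le_trans (ler_norm_sum _ _ _) _; rewrite !big_seq; apply: ler_sum => i.
rewrite mem_iota add0n => /andP[_ iN].
have [c] := @MVT_derive _ _ (t + i%:R * q) (t + i.+1%:R * q ) dG.
have -> : t + i.+1%:R * q - (t + i%:R * q) = q by rewrite -natr1; ring.
rewrite mul1r addrA -/t => cq ->.
set z := t + _ in cq *; rewrite [q * _]mulrC -mulrBl normrM.
have zC : `[- C, C]%classic z.
  rewrite /= in_itv/= -ler_norml /z /t.
  have iq : `|i%:R * q| <= `|h|.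
    rewrite /q mulrCA normrM ler_piMr// normrM normfV !normr_nat.
    by rewrite ler_pdivrMr// mul1r ler_nat ltnW.
  have := HB x Kx; have := ler_normD (dotp x w + b) (i%:R * q).
  by have := ler_normD (dotp x w) b; rewrite /C; lra.
have : `|g z - g c| < eps / (`|h| + 1).
  by apply: dP => //; rewrite distrC; apply: le_lt_trans hN.
rewrite distrC => gzc.
apply: (@le_trans _ _ (eps / (`|h| + 1) * `|q|)); first by rewrite ler_wpM2r// ltW.
rewrite /q normrM normfV (gtr0_norm N0) mulrA ler_wpM2r ?invr_ge0 ?ltW//.
by rewrite mulrAC ltr_pdivrMr// ltr_pM2l// ltrDl.
Qed.

(* The derivative at q = 0 of g (<x, w + q u> + b) is <x, u> g' (<x, w> + b). *)
Lemma ridge_approximable_derive u us (g g' : R -> R) : continuous g' ->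
  (forall x : R, is_derive x 1 g (g' x)) -> ridge_approximable us g ->
  ridge_approximable (u :: us) g'.
Proof.
move=> cg' dg gA w b; apply: approximable_uniform => K eps cK e0.
have [B B0 HB] := @continuous_compact_bounded _ _ _ K (@continuous_dotp w) cK.
have [D D0 HD] := @continuous_compact_bounded _ _ _ K (@continuous_dotp u) cK.
have [M M0 HM] := @continuous_compact_bounded _ _ _ K (@continuous_prod_dotp (u :: us)) cK.
pose C := B + `|b|.
have [d d0 dP] := @heine_cantor _ _ _ `[- C, C] _ cg' (@segment_compact _ _ _) (divr_gt0 e0 M0).
(* On [K] the argument of [g] moves by at most [q D = d / 2 < d]. *)
pose q := d / (2 * D).
have q0 : 0 < q by rewrite divr_gt0// mulr_gt0.
exists (fun x => q^-1 * ((\prod_(v <- us) dotp x v) * g (dotp x (w + q *: u) + b)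
   + (-1) * ((\prod_(v <- us) dotp x v) * g (dotp x w + b)))).
  apply: approximable_scale; apply: approximable_add; first exact: gA.
  by apply: approximable_scale; exact: gA.
move=> x Kx; rewrite big_cons dotpDr dotpZr.
have := HM x Kx; rewrite big_cons; move: (\prod_(v <- us) dotp x v) => Q.
have := HB x Kx; have := HD x Kx.
move: (dotp x w) (dotp x u) => s t tD sB QM.
have [c] := @MVT_derive _ _ (s + b) (s + q * t + b) dg.
have -> : s + q * t + b - (s + b) = q * t by ring.
rewrite normrM (gtr0_norm q0) => cs E.
have -> : t * Q * g' (s + b) - q^-1 * (Q * g (s + q * t + b) + -1 * (Q * g (s + b)))
  = (t * Q) * (g' (s + b) - g' c).
  have -> : Q * g (s + q * t + b) + -1 * (Q * g (s + b)) = Q * (g' c * (q * t)) by rewrite -E; ring.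
  by field; rewrite gt_eqF.
have gg : `|g' (s + b) - g' c| < eps / M.
  apply: dP.
    rewrite /= in_itv/= -ler_norml /C; apply: le_trans (ler_normD _ _) _.
    by rewrite lerD2r.
  rewrite distrC; apply: le_lt_trans cs _.
  apply: (@le_lt_trans _ _ (q * D)); first by rewrite ler_wpM2l// ltW.
  have -> : q * D = d / 2 by rewrite /q; field; rewrite gt_eqF.
  by lra.
rewrite normrM; apply: (@le_trans _ _ (M * (eps / M))).
  by apply: ler_pM => //; exact: ltW.
by rewrite mulrC divfK// gt_eqF.
Qed.

Lemma is_derive_shift_diff (h : R) (G g : R -> R) :
  (forall x : R, is_derive x 1 G (g x)) ->
  forall x : R, is_derive x 1 (shift_diff h G) (shift_diff h g x).
Proof.
move=> dG x; apply: is_deriveB.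
have dGx : is_derive (shift h x) 1 G (g (x + h)) by exact: dG.
by have := is_derive1_comp dGx (is_derive_shift x 1 h); rewrite mulr1.
Qed.

Lemma continuous_shift_diff (h : R) (g : R -> R) : continuous g ->
  continuous (shift_diff h g).
Proof.
move=> cg x; apply: cvgB; last exact: cg.
by apply: continuous_comp; [apply: cvgD; [exact: cvg_id|exact: cvg_cst]|exact: cg].
Qed.

(** The induction generalises [g]: its hypothesis is applied to [shift_diff h G], with [G] an
    antiderivative of [g], and one differentiation in the direction [u] then turns differences of
    [G] into differences of [g]. *)
Lemma ridge_approximable_iter (h : R) us (g : R -> R) : continuous g ->
  ridge_approximable [::] g ->
  ridge_approximable us (iter (size us) (shift_diff h) g).
Proof.
elim: us g => [//|u us IH] g cg gA.
have [G dG] := continuous_antiderivative cg.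
have cG : continuous G.
  by move=> x; apply: differentiable_continuous; apply/derivable1_diffP; have [] := dG x.
rewrite [size _]/= iterSr.
apply: (@ridge_approximable_derive u us (iter (size us) (shift_diff h) (shift_diff h G))).
- rewrite -iterSr; elim: (size us).+1 => [//|k ck]; exact: continuous_shift_diff.
- rewrite -!iterSr; elim: (size us).+1 => [//|k ck]; exact: is_derive_shift_diff.
- apply: IH; first exact: continuous_shift_diff.
  exact: ridge_approximable_integral gA.
Qed.

End Approximable.

(** * Continuous functions with vanishing iterated differences are polynomials *)

(** Newton's forward difference formula: the expansion of the difference sequence is summed by
    Pascal's rule, which raises each lower index by one. *)
Lemma newton_sequence (R : realType) (k : nat) (u : nat -> R) :
  (forall i, iter k (fun v i => v i.+1 - v i) u i = 0) ->
  exists a : nat -> R, forall i, u i = \sum_(j < k) a j * 'C(i, j)%:R.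
Proof.
elim: k u => [|k IH] u Hu; first by exists (fun=> 0) => i; rewrite big_ord0; exact: Hu.
have [i|a aP] := IH (fun i => u i.+1 - u i); first by rewrite -iterSr.
exists (fun j => if j is j'.+1 then a j' else u 0%N).
elim=> [|i IHi].
  by rewrite big_ord_recl big1 ?addr0 ?mulr1// => j _; rewrite /= bin0n mulr0.
rewrite -[LHS](subrK (u i)) aP IHi !big_ord_recl !bin0 addrCA -big_split.
by congr (_ + _); apply: eq_bigr => j _; rewrite /= binS natrD mulrDr addrC.
Qed.

Lemma binomial_poly (R : realType) (j : nat) :
  exists p : {poly R}, forall i : nat, p.[i%:R] = 'C(i, j)%:R.
Proof.
elim: j => [|j [p pP]]; first by exists 1 => i; rewrite hornerC bin0.
exists (p * ('X - j%:R%:P) * (j.+1%:R^-1)%:P) => i.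
rewrite !hornerM !hornerE pP.
apply: (mulIf (x := j.+1%:R)) => //; rewrite mulfVK// -natrM.
rewrite [('C(i, j.+1) * _)%N]mulnC mul_bin_left.
(* For [i < j] the subtraction [i - j] is truncated, but the binomial coefficient vanishes. *)
have [ji|ij] := leqP j i; first by rewrite natrM natrB// mulrC.
by rewrite bin_small// mul0r muln0.
Qed.

Lemma poly_nat_roots (R : realType) (p : {poly R}) :
  (forall i : nat, p.[i%:R] = 0) -> p = 0.
Proof.
move=> p0; apply: (@roots_geq_poly_eq0 _ _ [seq i%:R | i <- iota 0 (size p)]).
- by apply/allP => _ /mapP[i _ ->]; apply/rootP.
- by rewrite map_inj_uniq ?iota_uniq// => i j /eqP; rewrite eqr_nat => /eqP.
- by rewrite size_map size_iota.
Qed.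

(* On each grid of step 1/(N+1), Newton interpolation shows that sigma is a
   polynomial; all these polynomials agree on the natural numbers. *)
Lemma frechet_polynomial (R : realType) (k : nat) (sigma : R -> R) :
  continuous sigma ->
  (forall h t, iter k (shift_diff h) sigma t = 0) -> is_poly_fun sigma.
Proof.
move=> cs H.
have grid a h : exists p : {poly R}, forall i : nat, sigma (a + i%:R * h) = p.[i%:R].
  have [i|c cP] := @newton_sequence R k (fun i => sigma (a + i%:R * h)).
    rewrite -[RHS](H h (a + i%:R * h)); elim: {H} k i => [//|k IH] i.
    by rewrite /= !IH /shift_diff -natr1 mulrDl mul1r addrA.
  have [P PP] := choice (@binomial_poly R).
  exists (\sum_(j < k) c j *: P j) => i; rewrite cP horner_sum.
  by apply: eq_bigr => j _; rewrite hornerZ PP.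
have [p pP] := grid 0 1.
have {}pP (i : nat) : sigma i%:R = p.[i%:R] by rewrite -pP add0r mulr1.
have fine (M N i : nat) : sigma (- M%:R + i%:R / N.+1%:R) = p.[- M%:R + i%:R / N.+1%:R].
  have [q qP] := grid (- M%:R) (N.+1%:R^-1).
  have N0 : N.+1%:R != 0 :> R by [].
  (* The natural number [j] is the grid point of index [(j + M)(N + 1)], so after rescaling [q]
     agrees with [p] at all natural numbers. *)
  have /subr0_eq -> : p - (q \Po (('X + M%:R%:P) * N.+1%:R%:P)) = 0.
    apply: poly_nat_roots => j; rewrite !hornerE horner_comp !hornerE -pP.
    rewrite -natrD -natrM -qP natrM natrD mulfK//.
    by apply/eqP; rewrite subr_eq0; apply/eqP; congr sigma; ring.
  rewrite qP horner_comp !hornerE; congr (q.[_]).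
  by rewrite addrAC addNr add0r mulfVK.
exists p => x; apply/eqP; rewrite -subr_eq0; apply/negPn/negP => Dx.
have cD : continuous (fun x => sigma x - p.[x]).
  by move=> y; apply: cvgB; [exact: cs|exact: continuous_horner].
have := cD x; move=> /cvgrPdist_lt/(_ `|sigma x - p.[x]|); rewrite normr_gt0 => /(_ Dx).
move=> /nbhs_normP[d /= d0 dP].
(* [M] makes [x + M] nonnegative, so that truncation gives the grid point just below [x]; [N] makes
   the mesh at most [d]. As [sigma - p] vanishes at that point, [dP] would give
   [|sigma x - p x| < |sigma x - p x|]. *)
pose M := (Num.truncn `|x|).+1; pose N := Num.truncn d^-1.
have xM : 0 <= x + M%:R.
  have := Num.Theory.truncnS_gt `|x|; rewrite -/M.
  by have := ler_norm (- x); rewrite normrN; lra.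
have N0 : 0 < N.+1%:R :> R by [].
pose i := Num.truncn ((x + M%:R) * N.+1%:R).
have := dP (- M%:R + i%:R / N.+1%:R); rewrite /= fine subrr subr0 ltxx => /(_ _)/negP; apply => //.
have /andP[i1 i2] : i%:R <= (x + M%:R) * N.+1%:R < i.+1%:R.
  by apply: Num.Theory.truncn_itv; rewrite mulr_ge0.
have -> : x - (- M%:R + i%:R / N.+1%:R) = ((x + M%:R) * N.+1%:R - i%:R) / N.+1%:R.
  by field; rewrite gt_eqF.
rewrite /ball_/= normrM normfV (gtr0_norm N0) ger0_norm ?subr_ge0//.
rewrite ltr_pdivrMr//; apply: (@lt_le_trans _ _ 1); first by rewrite ltrBlDl natr1.
by rewrite mulrC -ler_pdivrMr// div1r ltW// Num.Theory.truncnS_gt.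
Qed.

(** * Bernstein operators in one variable *)

(* de Casteljau's recursion: this is sum_k 'C(N, k) t^k (1 - t)^(N - k) phi k. *)
Fixpoint bernstein (R : realType) (N : nat) (phi : nat -> R) (t : R) : R :=
  if N is N'.+1 then
    t * bernstein N' (fun k => phi k.+1) t + (1 - t) * bernstein N' phi t
  else phi 0%N.

Section Bernstein.
Variable R : realType.
Implicit Types (phi psi : nat -> R) (N : nat) (t : R).

Lemma bernstein_lin N phi psi a b t :
  bernstein N (fun k => a * phi k + b * psi k) t =
  a * bernstein N phi t + b * bernstein N psi t.
Proof. by elim: N phi psi => [//|N IH] phi psi; rewrite /= !IH; ring. Qed.

Lemma bernstein_cst N c t : bernstein N (fun=> c) t = c.
Proof. by elim: N => [//|N IH]; rewrite /= !IH; ring. Qed.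

(** For [t] in [[0, 1]] this is the second moment of a binomial variable about [c]: variance plus
    squared bias. A general [c] is kept because shifting [k] replaces [c] by [c - 1]. *)
Lemma bernstein_sqr N c t :
  bernstein N (fun k => (k%:R - c) ^+ 2) t = N%:R * (t * (1 - t)) + (N%:R * t - c) ^+ 2.
Proof.
elim: N c => [|N IH] c /=; first by ring.
have -> : (fun k => (k.+1%:R - c) ^+ 2) = (fun k => (k%:R - (c - 1)) ^+ 2).
  by apply/funext => k; rewrite -natr1; ring.
by rewrite !IH -natr1; ring.
Qed.

Lemma bernstein_ge0 N phi t : 0 <= t <= 1 ->
  (forall k, (k <= N)%N -> 0 <= phi k) -> 0 <= bernstein N phi t.
Proof.
move=> /[dup] t01 /andP[t0 t1]; elim: N phi => [|N IH] phi Hphi /=; first exact: Hphi.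
rewrite addr_ge0// mulr_ge0 ?subr_ge0 ?IH// => k kN; apply: Hphi => //.
exact: leqW.
Qed.

(** The operator is linear, positive and fixes constants, so it can be applied to
    [psi + (c - phi) >= 0] and [psi - (c - phi) >= 0]. *)
Lemma bernstein_dist N phi psi c t : 0 <= t <= 1 ->
  (forall k, (k <= N)%N -> `|c - phi k| <= psi k) ->
  `|c - bernstein N phi t| <= bernstein N psi t.
Proof.
move=> t01 H; rewrite ler_norml; apply/andP; split.
  rewrite -subr_ge0.
  have -> : c - bernstein N phi t - - bernstein N psi t =
      bernstein N (fun k => 1 * (1 * psi k + (-1) * phi k) + 1 * c) t.
    by rewrite !bernstein_lin bernstein_cst; ring.
  by apply: bernstein_ge0 => // k /H; rewrite ler_norml; lra.
rewrite -subr_ge0.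
have -> : bernstein N psi t - (c - bernstein N phi t) =
    bernstein N (fun k => 1 * (1 * psi k + 1 * phi k) + (-1) * c) t.
  by rewrite !bernstein_lin bernstein_cst; ring.
by apply: bernstein_ge0 => // k /H; rewrite ler_norml; lra.
Qed.

End Bernstein.

(** * Density on a box, one coordinate at a time *)

Definition box (R : realType) (n : nat) (A : R) : set 'rV[R]_n :=
  [set x | forall i, `|x ord0 i| <= A].

Definition upd (R : realType) (n : nat) (x : 'rV[R]_n) (j : 'I_n) (a : R) : 'rV[R]_n :=
  \row_i (if i == j then a else x ord0 i).

Section Box.
Variables (R : realType) (n : nat) (A : R) (P : ('rV[R]_n -> R) -> Prop).
Hypothesis A0 : 0 < A.
Hypothesis P_cst : forall c, P (fun=> c).
Hypothesis P_lin : forall a b f g, P f -> P g -> P (fun x => a * f x + b * g x).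
Hypothesis P_coord : forall j f, P f -> P (fun x => x ord0 j * f x).

Let P_eq f g : f =1 g -> P f -> P g.
Proof. by move=> /funext ->. Qed.

(** Each de Casteljau step multiplies by affine functions of [x_j]. The node values may depend on
    [x], since they will be approximants of slices of [f]. *)
Lemma bernstein_closed j N (phi : nat -> 'rV[R]_n -> R) : (forall k, P (phi k)) ->
  P (fun x => bernstein N (phi^~ x) ((x ord0 j + A) / (2 * A))).
Proof.
elim: N phi => [|N IH] phi Pphi; first exact: Pphi.
have P1 := IH _ (fun k => Pphi k.+1); have P0 := IH _ Pphi.
apply: P_eq (P_lin (2 * A)^-1 1 (P_coord j P1)
  (P_lin (2^-1) 1 P1 (P_lin (- (2 * A)^-1) (2^-1) (P_coord j P0) P0))) => x /=.
by field; rewrite gt_eqF.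
Qed.

Lemma bernstein_node (N k : nat) : (k <= N.+1)%N ->
  `|k%:R * (2 * A / N.+1%:R) - A| <= A.
Proof.
move=> kN; have A20 : 0 <= 2 * A by rewrite ltW// mulr_gt0.
rewrite ler_norml lerBrDl subrr mulr_ge0 ?divr_ge0//=.
rewrite lerBlDl mulrA ler_pdivrMr// (_ : A + A = 2 * A); last by ring.
by rewrite [k%:R * _]mulrC ler_wpM2l ?ler_nat.
Qed.

Lemma box_unit (x : 'rV[R]_n) j : box A x -> 0 <= (x ord0 j + A) / (2 * A) <= 1.
Proof.
have A20 : 0 < 2 * A by exact: mulr_gt0.
move=> /(_ j); rewrite ler_norml => /andP[x1 x2].
by rewrite divr_ge0 ?ler_pdivrMr//=; lra.
Qed.

(** Chebyshev's argument: nodes within [d] of [x_j] contribute at most [eps]; at the others the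
    error [2 M] is at most [2 M ((x_j - a) / d)^2], whose mean is controlled by the variance. *)
Lemma bernstein_coord (f : 'rV[R]_n -> R) (M : R) (j : 'I_n) (eps d : R) :
  0 < eps -> 0 < d -> (forall x, box A x -> `|f x| <= M) ->
  (forall x y, box A x -> box A y -> (forall i, `|x ord0 i - y ord0 i| < d) ->
     `|f x - f y| <= eps) ->
  exists N, forall x, box A x ->
    `|f x - bernstein N.+1 (fun k => f (upd x j (k%:R * (2 * A / N.+1%:R) - A)))
        ((x ord0 j + A) / (2 * A))| <= 2 * eps.
Proof.
move=> e0 d0 HM Hd.
(* The variance term equals [C eps t (1 - t) / (N + 1)], hence is at most [eps] once [N + 1 > C]. *)
pose C := 8 * M * A ^+ 2 / (d ^+ 2 * eps).
pose N := Num.truncn C; exists N => x bx.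
have N0 : 0 < N.+1%:R :> R by [].
have CN : C < N.+1%:R by exact: Num.Theory.truncnS_gt.
have M0 : 0 <= M by apply: le_trans (HM x bx).
set t := (_ + A) / _.
have t01 : 0 <= t <= 1 by exact/box_unit.
pose psi (k : nat) := 1 * eps + (2 * M / d ^+ 2 * (2 * A / N.+1%:R) ^+ 2) * (k%:R - N.+1%:R * t) ^+ 2.
apply: (@le_trans _ _ (bernstein N.+1 psi t)).
  apply: bernstein_dist => // k kN.
  set a := _ - A.
  have aA : `|a| <= A by exact: bernstein_node.
  have ub : box A (upd x j a).
    by move=> i; rewrite mxE; case: ifP.
  have -> : psi k = eps + 2 * M * ((x ord0 j - a) / d) ^+ 2.
    by rewrite /psi /a /t; field; rewrite !gt_eqF.
  have [xa|xa] := ltP `|x ord0 j - a| d.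
    apply: (@le_trans _ _ eps).
      apply: Hd => // i; rewrite mxE; case: eqP => [->//|_].
      by rewrite subrr normr0.
    by rewrite lerDl mulr_ge0 ?sqr_ge0// mulr_ge0.
  have : 1 <= ((x ord0 j - a) / d) ^+ 2.
    by rewrite -real_normK ?num_real// exprn_ege1// normrM normfV (gtr0_norm d0) ler_pdivlMr// mul1r.
  have := ler_normB (f x) (f (upd x j a)); have := HM _ bx; have := HM _ ub.
  move: ((_ / d) ^+ 2) => q h1 h2 h3 q1.
  have : 2 * M * 1 <= 2 * M * q by rewrite ler_wpM2l// mulr_ge0.
  by lra.
rewrite /psi (bernstein_lin _ (fun=> eps)) bernstein_cst bernstein_sqr subrr expr0n addr0.
have tt : t * (1 - t) <= 1.
  have : 0 <= t * t by rewrite -expr2 sqr_ge0.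
  by move: t01 => /andP[]; lra.
rewrite mul1r (_ : 2 * eps = eps + eps) ?lerD2l; last by ring.
have -> : 2 * M / d ^+ 2 * (2 * A / N.+1%:R) ^+ 2 * (N.+1%:R * (t * (1 - t)))
    = C * eps / N.+1%:R * (t * (1 - t)).
  by rewrite /C; field; rewrite !gt_eqF.
have C0 : 0 <= C * eps / N.+1%:R.
  by rewrite !mulr_ge0// ?invr_ge0 ?mulr_ge0 ?sqr_ge0// ltW.
apply: (@le_trans _ _ (C * eps / N.+1%:R)); first by rewrite ler_piMr.
by rewrite mulrAC ler_piMl ?ltW// ltr_pdivrMr// mul1r.
Qed.

(* Induction on m: Bernstein's operator in the coordinate m approximates f by
   combinations of functions that depend on the first m coordinates only. *)
Lemma box_dense_coord (m : nat) (f : 'rV[R]_n -> R) (M : R) :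
  (forall x y : 'rV[R]_n, (forall i : 'I_n, (i < m)%N -> x ord0 i = y ord0 i) -> f x = f y) ->
  (forall x, box A x -> `|f x| <= M) ->
  (forall eps, 0 < eps -> exists2 d, 0 < d & forall x y, box A x -> box A y ->
     (forall i, `|x ord0 i - y ord0 i| < d) -> `|f x - f y| <= eps) ->
  forall eps, 0 < eps -> exists2 p, P p & forall x, box A x -> `|f x - p x| <= eps.
Proof.
elim: m f => [|m IH] f fdep fM fU eps e0.
  exists (fun=> f 0); first exact: P_cst.
  by move=> x _; rewrite (fdep x 0)// subrr normr0 ltW.
have [nm|mn] := leqP n m.
  apply: IH => // x y xy; apply: fdep => i _; apply: xy.
  exact: leq_trans (ltn_ord i) nm.
pose j := Ordinal mn.
(* Bernstein's operator costs [2 (eps / 4)] and replacing the node functions costs another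
   [eps / 4]. *)
have e40 : 0 < eps / 4 by rewrite divr_gt0.
have [d d0 dP] := fU _ e40.
have [N NP] := bernstein_coord j e40 d0 fM dP.
have N0 : 0 < N.+1%:R :> R by [].
pose a (k : nat) := k%:R * (2 * A / N.+1%:R) - A.
have aA k : (k <= N.+1)%N -> `|a k| <= A by exact: bernstein_node.
have H k : exists q, P q /\ ((k <= N.+1)%N ->
    forall x, box A x -> `|f (upd x j (a k)) - q x| <= eps / 4).
  (* Indices beyond the nodes get the zero function, so that [choice] yields a total sequence. *)
  have [kN|] := leqP k N.+1; last by exists (fun=> 0); split.
  have ub x : box A x -> box A (upd x j (a k)).
    by move=> bx i; rewrite mxE; case: ifP => // _; exact: aA.
  have [||e e1|q Pq qP] := IH (fun x => f (upd x j (a k))) _ _ _ _ e40; last by exists q.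
  - move=> x y xy; apply: fdep => i im; rewrite !mxE; case: eqP => // ij.
    apply: xy; rewrite ltn_neqAle -ltnS im andbT; apply: contra_notN ij => /eqP ij.
    exact: val_inj.
  - by move=> x /ub /fM.
  - have [r r0 rP] := fU _ e1; exists r => // x y bx By xy.
    apply: rP; [exact: ub|exact: ub|] => i; rewrite !mxE; case: ifP => // _.
    by rewrite subrr normr0.
have [p pP] := choice H.
exists (fun x => bernstein N.+1 (p^~ x) ((x ord0 j + A) / (2 * A))).
  by apply: bernstein_closed => k; have [] := pP k.
move=> x bx; have := NP x bx.
set t := (_ + A) / _.
have t01 : 0 <= t <= 1 by exact/box_unit.
set b := bernstein _ _ _ => fb.
have : `|0 - bernstein N.+1 (fun k => 1 * f (upd x j (a k)) + (-1) * p k x) t|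
    <= bernstein N.+1 (fun=> eps / 4) t.
  apply: bernstein_dist => // k kN; rewrite sub0r normrN mul1r mulN1r.
  by have [_ ->] := pP k.
rewrite bernstein_cst bernstein_lin sub0r normrN mul1r mulN1r -/b => bp.
by have := ler_distD b (f x) (bernstein N.+1 (p^~ x) t); lra.
Qed.

Lemma compact_box : compact (@box R n A).
Proof.
have := @rV_compact R n (fun=> `[- A, A]%classic) (fun=> @segment_compact R _ _).
by congr compact; apply/seteqP; split => x H i; have := H i; rewrite /= in_itv/= -ler_norml.
Qed.

Lemma box_dense (f : 'rV[R]_n -> R) (eps : R) : continuous f -> 0 < eps ->
  exists2 p, P p & forall x, box A x -> `|f x - p x| <= eps.
Proof.
move=> cf; have [M M0 HM] := continuous_compact_bounded cf compact_box.
apply: (@box_dense_coord n f M) => //.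
  move=> x y xy; congr f; apply/rowP => i; exact: xy.
move=> e e0; have [d d0 dP] := heine_cantor cf compact_box e0.
exists d => // x y bx By xy; apply/ltW/dP => //.
rewrite [`|_|]mx_normrE; apply/bigmax_ltP; split => // -[i j] _ /=.
by rewrite ord1 !mxE.
Qed.

End Box.

(** * From networks to sections of the kernel *)

(** Solvability of the normal equations: a vector [u] in the row space of [P] with [u P^T = 0] has
    [u u^T = 0], a sum of squares, so [u = 0] and no rank is lost in [P P^T]. *)
Lemma sub_mulmx_tr (R : realFieldType) (s m : nat) (P : 'M[R]_(s, m)) :
  (P^T <= P *m P^T)%MS.
Proof.
rewrite -(mxrank_leqif_sup (submxMl P P^T)).2.
rewrite mxrank_tr -[X in _ == X](mxrank_mul_ker P P^T).
suff -> : (P :&: kermx P^T)%MS = 0 by rewrite mxrank0 addn0.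
apply/eqP; rewrite -submx0; apply/rV_subP => u.
rewrite sub_capmx => /andP[/submxP[v uP] /sub_kermxP uk].
have uu : u *m u^T = 0 by rewrite {2}uP trmx_mul mulmxA uk mul0mx.
suff -> : u = 0 by exact: sub0mx.
apply/rowP => i; rewrite mxE; apply/eqP; rewrite -sqrf_eq0 eq_le sqr_ge0 andbT.
have := congr1 (fun M : 'M[R]_1 => M ord0 ord0) uu; rewrite !mxE => <-.
rewrite (bigD1 i)//= mxE expr2 lerDl; apply: sumr_ge0 => j _.
by rewrite mxE -expr2 sqr_ge0.
Qed.

(** Take a finite list of points whose span has maximal rank, which is at most [m]; one more point
    cannot enlarge the span. *)
Lemma finite_row_span (R : realFieldType) (T : Type) (m : nat) (Phi : T -> 'rV[R]_m) :
  exists (s : nat) (xs : 'I_s -> T),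
    forall x, (Phi x <= \matrix_(l < s) Phi (xs l))%MS.
Proof.
pose S (xs : seq T) := (\sum_(y <- xs) <<Phi y>>)%MS.
have exS : exists r, `[< exists xs, \rank (S xs) = r >].
  by exists (\rank (S [::])); apply/asboolP; exists [::].
have ubS r : `[< exists xs, \rank (S xs) = r >] -> (r <= m)%N.
  by move=> /asboolP[xs <-]; exact: rank_leq_col.
case: (ex_maxnP exS ubS) => r /asboolP[xs xsr] rmax.
exists (size xs), (tnth (in_tuple xs)) => x.
have xS : (Phi x <= S xs)%MS.
  have SS : (S xs <= S (x :: xs))%MS by rewrite /S big_cons addsmxSr.
  have : (S (x :: xs) <= S xs)%MS.
    rewrite -(mxrank_leqif_sup SS).2 eqn_leq mxrankS//= xsr rmax//.
    by apply/asboolP; exists (x :: xs).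
  apply: submx_trans; rewrite /S big_cons.
  by apply: submx_trans (addsmxSl _ _); rewrite genmxE.
apply: submx_trans xS _; rewrite /S big_tnth; apply/sumsmx_subP => l _.
rewrite genmxE; set B := \matrix_(_ < _) _.
by rewrite (_ : Phi _ = row l B) ?row_sub// rowK.
Qed.

(* The coefficient vector [a] only matters up to its orthogonal projection on the
   span of the feature vectors [Phi x], which is a combination of finitely many
   of them. *)
Lemma feature_kernel_sections (R : realFieldType) (T : Type) (m : nat)
    (phi : 'I_m -> T -> R) (a : 'I_m -> R) :
  exists (s : nat) (d : 'I_s -> R) (xs : 'I_s -> T), forall x,
    \sum_j a j * phi j x = \sum_l d l * \sum_j phi j x * phi j (xs l).
Proof.
pose Phi x := \row_j phi j x.
have [s [xs xsP]] := @finite_row_span R T m Phi.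
set P := \matrix_(_ < _) _ in xsP.
(* The equation [a P^T = d P P^T] says that [a - d P] is orthogonal to the chosen feature vectors,
   hence to every [Phi x]. *)
have /submxP[d dP] : (\row_j a j *m P^T <= P *m P^T)%MS.
  exact: submx_trans (submxMl _ _) (sub_mulmx_tr P).
exists s, (fun l => d 0 l), xs => x.
have /submxP[v xv] := xsP x.
have : \row_j a j *m (Phi x)^T = d *m P *m (Phi x)^T.
  by rewrite xv trmx_mul !mulmxA dP mulmxA.
move=> /(congr1 (fun M : 'M[R]_1 => M 0 0)); rewrite -mulmxA !mxE.
under eq_bigr do rewrite !mxE.
move=> ->; apply: eq_bigr => l _; rewrite !mxE; congr (_ * _).
by apply: eq_bigr => j _; rewrite !mxE mulrC.
Qed.

(** * Density of networks and universality *)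

Lemma approximable_prod_dotp (R : realType) (n : nat) (sigma : R -> R)
    (us : seq 'rV[R]_n) : continuous sigma -> ~ is_poly_fun sigma ->
  approximable sigma (fun x => \prod_(u <- us) dotp x u).
Proof.
move=> cs npoly.
have [h [b Db]] : exists h b, iter (size us) (shift_diff h) sigma b <> 0.
  apply: contrapT => H; apply: npoly; apply: (@frechet_polynomial _ (size us)) => // h t.
  by apply: contrapT => Dt; apply: H; exists h, t.
(* At [w = 0] the ridge factor is the nonzero constant of [Db], which is divided out. *)
have := ridge_approximable_iter h us cs (@ridge_approximable_sigma R n sigma) 0 b.
move=> /(approximable_scale (iter (size us) (shift_diff h) sigma b)^-1).
apply: approximable_eq => x; rewrite dotp0r add0r mulrCA mulVf ?mulr1//.
exact/eqP.
Qed.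

Lemma approximable_continuous (R : realType) (n : nat) (sigma : R -> R)
    (f : 'rV[R]_n -> R) : continuous sigma -> ~ is_poly_fun sigma ->
  continuous f -> approximable sigma f.
Proof.
move=> cs npoly cf; apply: approximable_uniform => K eps cK e0.
have [A A0 KA] := continuous_compact_bounded (@norm_continuous R 'rV[R]_n) cK.
(* Quantifying over [us] makes [P] stable under multiplication by a coordinate: [x_j] is absorbed as
   one more linear form, with direction [delta_mx ord0 j]. *)
pose P (p : 'rV[R]_n -> R) := forall us,
  approximable sigma (fun x => (\prod_(u <- us) dotp x u) * p x).
have Pcst c : P (fun=> c).
  move=> us; have := approximable_scale c (approximable_prod_dotp us cs npoly).
  by apply: approximable_eq => x; rewrite mulrC.
have Plin a b p q : P p -> P q -> P (fun x => a * p x + b * q x).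
  move=> Pp Pq us; have := approximable_add (approximable_scale a (Pp us))
    (approximable_scale b (Pq us)).
  by apply: approximable_eq => x; ring.
have Pcoord j p : P p -> P (fun x => x ord0 j * p x).
  move=> Pp us; have := Pp (delta_mx ord0 j :: us).
  apply: approximable_eq => x; rewrite big_cons [dotp x _](bigD1 j)//= big1.
    by rewrite mxE !eqxx mulr1 addr0 mulrCA mulrA.
  by move=> i ij; rewrite mxE (negPf ij) andbF mulr0.
have [p Pp fp] := box_dense A0 Pcst Plin Pcoord cf e0.
exists p.
  by apply: approximable_eq (Pp [::]) => x; rewrite big_nil mul1r.
move=> x Kx; apply: fp => i; have := KA x Kx; rewrite normr_id; apply: le_trans.
rewrite [leRHS]mx_normrE; exact: (le_bigmax _ (fun ij => `|x ij.1 ij.2|) (ord0, i)).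
Qed.

Theorem theorem5p3 (R : realType) (n : nat) (sigma : R -> R) :
  continuous sigma -> ~ is_poly_fun sigma ->
  forall (f : 'rV[R]_n -> R) (K : set 'rV[R]_n) (eps : R),
    continuous f -> compact K -> 0 < eps ->
    exists (k : 'rV[R]_n -> 'rV[R]_n -> R) (s : nat)
           (d : 'I_s -> R) (xs : 'I_s -> 'rV[R]_n),
      in_F_sigma sigma k /\
      exists delta : R, delta < eps /\
        forall x, K x -> `|f x - \sum_(l < s) d l * k x (xs l)| <= delta.
Proof.
move=> cs npoly f K eps cf cK e0.
have e20 : 0 < eps / 2 by rewrite divr_gt0.
have [s sP] := approximable_continuous cs npoly cf cK e20.
pose p j := tnth (in_tuple s) j.
have [m [d [xs E]]] := feature_kernel_sections
  (fun j x => sigma (dotp x (p j).2.1 + (p j).2.2)) (fun j => (p j).1).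
(* All [c_j] are 1; the output weights of the network, of any sign, are absorbed into [d]. *)
exists (fun x y => \sum_(j < size s) 1 * sigma (dotp x (p j).2.1 + (p j).2.2)
                                       * sigma (dotp y (p j).2.1 + (p j).2.2)), m, d, xs.
split.
  by exists (size s), (fun=> 1), (fun j => (p j).2.1), (fun j => (p j).2.2); split.
exists (eps / 2); split; first by lra.
move=> x Kx; have := sP x Kx; rewrite /net big_tnth E.
by congr (`|_ - _| <= _); apply: eq_bigr => l _; under eq_bigr do rewrite -[_ * _]mul1r mulrA.
Qed.
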